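(* Let $G$ be a finite abelian group, let $S$ be a generating set of $G$, and let $X=X(G,S)$ be the associated directed Cayley graph. Let $p$ be a prime and let $X_m$ ($m\ge 0$) denote the $m$-th layer of the constant $\mathbb{Z}_p$-tower of $X$. Then the defect satisfies $\delta(X_m)=0$ for all $m\geq 0$.
   Context: A digraph $X$ has a vertex set $V(X)$ and a set $E(X)$ of directed edges (loops and multiple edges allowed), each edge $e$ having an origin $o(e)$ and a terminus $t(e)$. For a group $G$ and a generating set $S$ of $G$, the (directed) Cayley graph $X(G,S)$ has vertex set $G$ and, for every $g\in G$ and $s\in S$, one directed edge from $g$ to $gs$. Constant tower: for a finite digraph $X$ and a prime $p$, let $\Gamma\simeq\mathbb{Z}_p$ (written multiplicatively) have topological generator $\theta$, and let $\theta_m$ be the image of $\theta$ in $\Gamma/\Gamma^{p^m}\simeq\mathbb{Z}/p^m\mathbb{Z}$. The layer $X_m$ of the constant $\mathbb{Z}_p$-tower is the derived digraph of the constant voltage assignment $e\mapsto\theta_m$: its vertex set is $V(X)\times \Gamma/\Gamma^{p^m}$, its edge set is $E(X)\times\Gamma/\Gamma^{p^m}$, and the edge $(e,g)$ goes from $(o(e),g)$ to $(t(e),g\theta_m)$. In particular $X_0=X$. Defect: the adjacency matrix $A_X=[a_{ij}]$ of a finite digraph $X$ has $a_{ij}$ equal to the number of edges from $v_i$ to $v_j$. Let $a(X)$ and $b(X)$ be respectively the algebraic and the geometric multiplicity of $1$ as an eigenvalue of $A_X$ (each is $0$ if $1$ is not an eigenvalue). The defect is $\delta(X)=a(X)-b(X)$.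 *)

(* Defs.v *)
From HB Require Import structures.
From mathcomp Require Import all_boot all_order all_algebra all_fingroup.
From mathcomp Require Import all_field.

Set Implicit Arguments.
Unset Strict Implicit.
Unset Printing Implicit Defensive.

Import GRing.Theory.

(* Finite directed multigraphs with loops. *)
Record digraph := Digraph {
  vertex : finType;
  edge : finType;
  origin : edge -> vertex;
  terminus : edge -> vertex
}.

Section Defect.
Local Open Scope ring_scope.

Variable X : digraph.

(* The vertices are numbered by enum_val; the integer entries are seen in
   algC, so that all eigenvalues are available. *)
Definition adjacency : 'M[algC]_#|vertex X| :=
  \matrix_(i, j) #|[set e : edge X | (origin e == enum_val i)
                                   && (terminus e == enum_val j)]|%:R.

Definition alg_mult1 : nat := mup 1 (char_poly adjacency).

(* eigenspace M a is made of the row vectors u with u *m M = a *: u; the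
   transpose turns it into the space of usual (column) eigenvectors. *)
Definition geom_mult1 : nat := \rank (eigenspace adjacency^T 1).

(* The difference is taken in int, since subtraction on nat is truncated. *)
Definition defect : int := alg_mult1%:Z - geom_mult1%:Z.

End Defect.

Local Open Scope group_scope.

Definition cayley (gT : finGroupType) (S : {set gT}) : digraph :=
  @Digraph gT (gT * {s : gT | s \in S})%type
    (fun e => e.1) (fun e => e.1 * val e.2).

Definition derived (X : digraph) (H : finGroupType) (alpha : edge X -> H) :
    digraph :=
  @Digraph (vertex X * H)%type (edge X * H)%type
    (fun eg => (origin eg.1, eg.2))
    (fun eg => (terminus eg.1, eg.2 * alpha eg.1)).

(* Z/p^m, as a finGroupType whose law, written multiplicatively, is addition
   mod p^m. The type 'Z_(p ^ m) would be wrong for m = 0, where it is Z/2;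
   the (_).-1.+1 exhibits p ^ m as a successor. *)
Definition Zpow (p m : nat) : finGroupType := 'I_(p ^ m).-1.+1.

(* The inverse limit of the Z/p^m; Gamma/Gamma^(p^m) is identified with Z/p^m
   by the projection x |-> x m. *)
Record padic_int (p : nat) := PadicInt {
  padic_proj :> forall m, Zpow p m;
  padic_compat : forall m, (padic_proj m.+1 %% p ^ m)%N = padic_proj m
}.

(* The powers of theta are dense: every x is congruent to a power of theta
   modulo each of the basic open subgroups p^m Z_p. *)
Definition topological_generator (p : nat) (theta : padic_int p) : Prop :=
  forall (x : padic_int p) (m : nat), x m \in <[theta m]>.

Definition constant_layer (X : digraph) (p : nat) (theta : padic_int p)
    (m : nat) : digraph :=
  @derived X (Zpow p m) (fun=> theta m).

(* Main.v *)
Require Import Defs.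
From mathcomp Require Import all_boot all_order all_algebra all_fingroup.
From mathcomp Require Import all_field.

(** A layer of the constant tower over a Cayley digraph is itself
    translation-invariant: left multiplication by an element of the group
    [W = G * (Z/p^m)] permutes the edges compatibly with origins and termini,
    because every edge goes from a vertex [x] to a right translate of [x].
    The adjacency matrix [A] thus satisfies [A (w x) (w y) = A x y].

    As [W] is abelian, this makes [A] normal ([adjacency_normal]): in the sum
    over [z] giving an entry of [A *m A^T], the substitution
    [z := x * y * z^-1] yields the same entry of [A^T *m A].  By the spectral
    theorem a normal matrix is diagonalizable, and for a diagonalizable matrix
    the algebraic and geometric multiplicities of an eigenvalue agree
    ([mup_char_poly_diagonalized]): both count the occurrences of that
    eigenvalue on the diagonal. *)

Set Implicit Arguments.
Unset Strict Implicit.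
Unset Printing Implicit Defensive.

Import GRing.Theory Num.Theory.

Local Open Scope ring_scope.
Local Open Scope sesquilinear_scope.

Lemma char_poly_conj (F : fieldType) n (P B : 'M[F]_n) : P \in unitmx ->
  char_poly (invmx P *m B *m P) = char_poly B.
Proof.
move=> Pu; rewrite /char_poly /char_poly_mx !map_mxM /=.
set Q := map_mx polyC P; set Q' := map_mx polyC (invmx P).
set M := map_mx polyC B.
have QQ : Q' *m Q = 1%:M by rewrite -map_mxM mulVmx ?map_mx1.
have -> : 'X%:M - Q' *m M *m Q = Q' *m ('X%:M - M) *m Q.
  by rewrite mulmxBr mulmxBl mul_mx_scalar -scalemxAl QQ scalemx1.
by rewrite !det_mulmx mulrAC -det_mulmx QQ det1 mul1r.
Qed.

Lemma rank_diag_mx (F : fieldType) n (d : 'rV[F]_n) :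
  \rank (diag_mx d) = #|[pred i | d 0 i != 0]|.
Proof.
rewrite -sum1_card big_mkcond /=.
elim: n d => [|n IHn] d; first by rewrite big_ord0 [diag_mx _]flatmx0 mxrank0.
rewrite big_ord_recl; under eq_bigr => i _ do rewrite -rshift1.
have -> : \rank (diag_mx d) = (\rank (diag_mx (@lsubmx _ 1 1 n d))
                               + \rank (diag_mx (@rsubmx _ 1 1 n d)))%N.
  by rewrite -rank_diag_block_mx -diag_mx_row hsubmxK.
rewrite IHn.
congr addn; last by apply: eq_bigr => i _; rewrite !inE !mxE.
have -> : diag_mx (@lsubmx _ 1 1 n d) = (d 0 0)%:M.
  rewrite [diag_mx _]mx11_scalar !mxE eqxx mulr1n; congr (d _ _)%:M.
  exact: val_inj.
rewrite rank_rV !inE -scalemx1 scaler_eq0 negb_or oner_eq0 andbT.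
by case: (_ != 0).
Qed.

(** In a basis of eigenvectors, the characteristic polynomial is the product of
    the [X - d_i], so that the algebraic multiplicity of [a] is the number of
    [i] with [d_i = a]; and [A - a] has rank the number of [i] with
    [d_i != a], which leaves the same number for the dimension of its kernel. *)
Lemma mup_char_poly_diagonalized (F : fieldType) n (P A : 'M[F]_n)
    (d : 'rV[F]_n) (a : F) :
    P \in unitmx -> A = invmx P *m diag_mx d *m P ->
  mup a (char_poly A) = \rank (eigenspace A^T a).
Proof.
move=> Pu ->; rewrite char_poly_conj // char_poly_trig ?diag_mx_is_trig //.
have -> : mup a (\prod_(i < n) ('X - (diag_mx d i i)%:P))
          = #|[pred i | d 0 i == a]|.
  have -> : \prod_(i < n) ('X - (diag_mx d i i)%:P)
            = \prod_(y <- [seq d 0 i | i <- enum 'I_n]) ('X - y%:P).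
    by rewrite big_map big_enum; apply: eq_bigr => i _; rewrite mxE eqxx.
  by rewrite mu_prod_XsubC count_map -size_filter cardE !enumT.
rewrite mxrank_ker -mxrank_tr raddfB /= trmxK tr_scalar_mx.
have -> : invmx P *m diag_mx d *m P - a%:M
          = invmx P *m diag_mx (d - const_mx a) *m P.
  rewrite raddfB /= diag_const_mx mulmxBr mulmxBl mul_mx_scalar -scalemxAl.
  by rewrite mulVmx // scalemx1.
rewrite mxrankMfree ?row_free_unit // -mxrank_tr trmx_mul.
rewrite mxrankMfree ?row_free_unit ?unitmx_tr ?unitmx_inv // mxrank_tr.
have -> : \rank (diag_mx (d - const_mx a)) = #|[predC [pred i | d 0 i == a]]|.
  by rewrite rank_diag_mx; apply: eq_card => i; rewrite !inE !mxE subr_eq0.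
rewrite -[in X in (X - _)%N](card_ord n) -(cardC [pred i | d 0 i == a]).
by rewrite addnK.
Qed.

Lemma defect0_normal (X : digraph) : adjacency X \is normalmx -> defect X = 0.
Proof.
move=> /orthomx_spectralP AE; rewrite /defect /alg_mult1 /geom_mult1.
by rewrite (mup_char_poly_diagonalized 1 (spectral_unit _) AE) subrr.
Qed.

(** A family of edge maps covering the left translations, each injective,
    is enough: translating by [w] and then by [w^-1] turns the inequality of
    edge counts given by injectivity into an equality. *)
Lemma adjacency_normal (W : finGroupType) (E : finType) (o t : E -> W)
    (shift : W -> E -> E) :
    commutative (@mulg W) ->
    (forall w, injective (shift w)) ->
    (forall w e, o (shift w e) = (w * o e)%g) ->
    (forall w e, t (shift w e) = (w * t e)%g) ->
  adjacency (Digraph o t) \is normalmx.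
Proof.
move=> mulC shift_inj oshift tshift.
pose N x y := #|[set e | (o e == x) && (t e == y)]|.
have leN w x y : (N x y <= N (w * x)%g (w * y)%g)%N.
  rewrite /N -(card_imset _ (shift_inj w)); apply/subset_leq_card/subsetP => e.
  move=> /imsetP[e' + ->]; rewrite !inE oshift tshift => /andP[/eqP-> /eqP->].
  by rewrite !eqxx.
have N_translate w x y : N (w * x)%g (w * y)%g = N x y.
  by apply/eqP; rewrite eqn_leq leN andbT (leq_trans (leN w^-1%g _ _)) ?mulKg.
apply/normalmxP/matrixP => i j; rewrite !mxE.
set x := enum_val i; set y := enum_val j.
have sumE (f : W -> algC) :
    \sum_(k < #|vertex (Digraph o t)|) f (enum_val k) = \sum_z f z.
  by rewrite (reindex _ (onW_bij _ (enum_val_bij W))).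
transitivity (\sum_(z : W) (N x z * N y z)%:R : algC).
  by rewrite -sumE; apply: eq_bigr => k _; rewrite !mxE conjC_nat natrM.
transitivity (\sum_(z : W) (N z x * N z y)%:R : algC); last first.
  by rewrite -sumE; apply: eq_bigr => k _; rewrite !mxE conjC_nat natrM.
have inj : injective (fun z => x * y * z^-1)%g.
  by move=> z z' /mulgI /invg_inj.
rewrite [RHS](reindex_inj inj); apply: eq_bigr => z _ /=.
(* Translation by [z * x^-1] (resp. [z * y^-1]) takes [(x * y * z^-1, x)]
   to [(y, z)] (resp. [(x * y * z^-1, y)] to [(x, z)]). *)
rewrite mulnC; congr (_ * _)%:R.
  rewrite -(N_translate (z * x^-1)%g (_ * _)%g) mulgKV.
  by rewrite !mulgA mulgKV (mulC z) mulgK.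
rewrite -(N_translate (z * y^-1)%g (_ * _)%g) mulgKV.
by rewrite (mulC x y) !mulgA mulgKV (mulC z) mulgK.
Qed.

Theorem theorem3p15 (gT : finGroupType) (S : {set gT}) (p : nat)
    (theta : padic_int p) (m : nat) :
  abelian [set: gT] ->
  <<S>>%g = [set: gT] ->
  prime p ->
  topological_generator theta ->
  defect (constant_layer (cayley S) theta m) = 0%R.
Proof.
move=> /centsP abG _ _ _; apply: defect0_normal.
pose shift (w : gT * Zpow p m) (e : edge (constant_layer (cayley S) theta m))
  : edge (constant_layer (cayley S) theta m) :=
  ((w.1 * e.1.1, e.1.2), w.2 * e.2)%g.
apply: (@adjacency_normal (gT * Zpow p m)%type _ _ _ shift).
- move=> [w1 w2] [v1 v2]; congr (_, _); last exact: Zp_mulgC.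
  by apply: abG; rewrite inE.
- move=> w; apply: (can_inj (g := shift w^-1%g)) => -[[g s] h].
  by rewrite /shift /=; congr (_, _, _); exact: mulKg.
- by [].
- by move=> w [[g s] h]; congr (_, _); rewrite /= mulgA.
Qed.
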